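(* Every variety of lattices is fluid. That is, let $V$ be any variety of lattices, regarded as a variety of algebras of type $(2,2)$ with operation symbols $\vee,\wedge$. Then for every hypersubstitution $\sigma$ of type $(2,2)$, if $V_{\sigma}\subseteq V$ then $V_{\sigma}=V$.
   Context: A hypersubstitution of type $(2,2)$ is a choice $\sigma$ of two binary terms $\sigma(\vee),\sigma(\wedge)$ (terms in the two variables $x,y$ built from the symbols $\vee,\wedge$). For an algebra $\mathbf{A}=(A,\vee^{\mathbf{A}},\wedge^{\mathbf{A}})$ the derived algebra is $\mathbf{A}_{\sigma}=(A,\sigma(\vee)^{\mathbf{A}},\sigma(\wedge)^{\mathbf{A}})$, again of type $(2,2)$, where $t^{\mathbf{A}}$ is the term operation induced by $t$ on $\mathbf{A}$. For a variety $V$, the derived variety $V_{\sigma}$ is the variety generated by $\{\mathbf{A}_{\sigma}:\mathbf{A}\in V\}$. A derived variety $V_\sigma$ is proper if $V_{\sigma}\neq V$. A variety $V$ is fluid if it contains no proper derived variety $V_{\sigma}$, for any hypersubstitution $\sigma$ of its type. *)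

(* Defs.v *)
From mathcomp Require Import all_boot.
From mathcomp Require Import boolp classical_sets.

Set Implicit Arguments.
Unset Strict Implicit.
Unset Printing Implicit Defensive.

Local Open Scope classical_set_scope.

(* Algebras of type (2,2); carriers are nonempty, as usual in universal
   algebra, but [join] and [meet] are otherwise arbitrary. *)
Record algebra := Algebra {
  carrier :> Type;
  join : carrier -> carrier -> carrier;
  meet : carrier -> carrier -> carrier;
  nonempty : inhabited carrier
}.

Definition is_hom (A B : algebra) (f : A -> B) : Prop :=
  {morph f : a b / join a b >-> join a b} /\
  {morph f : a b / meet a b >-> meet a b}.

Lemma prod_nonempty (I : Type) (A : I -> algebra) :
  inhabited (forall i, A i).
Proof.
have ex i : exists _ : A i, True by case: (nonempty (A i)) => a; exists a.
by constructor => i; case: (cid (ex i)).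
Qed.

Definition prod_algebra (I : Type) (A : I -> algebra) : algebra :=
  @Algebra (forall i, A i)
    (fun a b i => join (a i) (b i))
    (fun a b i => meet (a i) (b i))
    (prod_nonempty A).

(* Closure under H, S and P. Subalgebras are taken up to isomorphism, that is,
   as domains of embeddings; products may have an empty family of factors. *)
Definition is_variety (V : set algebra) : Prop :=
  [/\ forall (A B : algebra) (f : A -> B),
        is_hom f -> (forall b, exists a, f a = b) -> V A -> V B,
      forall (A B : algebra) (f : A -> B),
        is_hom f -> injective f -> V B -> V A
    & forall (I : Type) (A : I -> algebra),
        (forall i, V (A i)) -> V (prod_algebra A)].

Definition variety_generated_by (K : set algebra) : set algebra :=
  smallest is_variety K.

Definition is_lattice (A : algebra) : Prop :=
  [/\ commutative (@join A), commutative (@meet A),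
      associative (@join A), associative (@meet A)
    & (forall a b : A, join a (meet a b) = a) /\
      (forall a b : A, meet a (join a b) = a)].

Definition is_variety_of_lattices (V : set algebra) : Prop :=
  is_variety V /\ V `<=` is_lattice.

Inductive binary_term :=
  | VarX
  | VarY
  | Join of binary_term & binary_term
  | Meet of binary_term & binary_term.

Fixpoint term_op (A : algebra) (t : binary_term) (x y : A) : A :=
  match t with
  | VarX => x
  | VarY => y
  | Join t1 t2 => join (term_op t1 x y) (term_op t2 x y)
  | Meet t1 t2 => meet (term_op t1 x y) (term_op t2 x y)
  end.

Record hypersubstitution := Hypersubstitution {
  join_term : binary_term;
  meet_term : binary_term
}.

Definition derived_algebra (s : hypersubstitution) (A : algebra) : algebra :=
  @Algebra A (term_op (join_term s)) (term_op (meet_term s)) (nonempty A).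

Definition derived_variety (V : set algebra) (s : hypersubstitution) :
    set algebra :=
  variety_generated_by (derived_algebra s @` V).

Definition proper_derived (V : set algebra) (s : hypersubstitution) : Prop :=
  derived_variety V s <> V.

Definition fluid (V : set algebra) : Prop :=
  ~ exists s, proper_derived V s /\ derived_variety V s `<=` V.

Lemma fluidE (V : set algebra) :
  fluid V <->
  (forall s, derived_variety V s `<=` V -> derived_variety V s = V).
Proof.
split=> [fl s sV|fl [s [prop /fl]]]; last exact: prop.
by apply: contrapT => prop; apply: fl; exists s.
Qed.

(* Main.v *)
(* The free lattice on x, y has only the elements x, y, x \/ y and x /\ y, so
   on lattices a hypersubstitution acts by one of these on each symbol. If the
   derived algebra of a lattice A with more than one element is a lattice, then
   commutativity excludes the projections and absorption excludes using the
   same operation twice; hence the derivation is the identity or the duality,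
   an involution in either case. So A is its own second derived algebra. If
   V_sigma is contained in V, then A_sigma lies in V for A in V, and therefore
   A = (A_sigma)_sigma lies in V_sigma. *)
Require Import Defs.
From mathcomp Require Import all_boot.
From mathcomp Require Import boolp classical_sets.

Local Open Scope classical_set_scope.

Definition dual_algebra (A : algebra) : algebra :=
  @Algebra A (@meet A) (@join A) (Defs.nonempty A).

Lemma dual_lattice (A : algebra) : is_lattice A -> is_lattice (dual_algebra A).
Proof. by case=> jC mC jA mA [jmK mjK]. Qed.

(** The join table of the four elements [x], [y], [join x y], [meet x y], bundled into one multirule
    for [rewrite]. *)
Lemma lattice_joinE (A : algebra) (lA : is_lattice A) (x y : A) :
  ((join x x = x) * (join y y = y) * (join y x = join x y) *
   (join (join x y) (join x y) = join x y) *
   (join (meet x y) (meet x y) = meet x y) *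
   (join x (join x y) = join x y) * (join y (join x y) = join x y) *
   (join (join x y) x = join x y) * (join (join x y) y = join x y) *
   (join x (meet x y) = x) * (join y (meet x y) = y) *
   (join (meet x y) x = x) * (join (meet x y) y = y) *
   (join (join x y) (meet x y) = join x y) *
   (join (meet x y) (join x y) = join x y))%type.
Proof.
case: lA => jC mC jA mA [jmK mjK].
have jj (z : A) : join z z = z by rewrite -{2}(mjK z z) jmK.
have xxy : join x (join x y) = join x y by rewrite jA jj.
have xyy : join (join x y) y = join x y by rewrite -jA jj.
have ymxy : join y (meet x y) = y by rewrite mC jmK.
have jxymxy : join (join x y) (meet x y) = join x y by rewrite -jA ymxy.
do !split=> //; rewrite ?jj // jC //.
Qed.

Lemma lattice_meetE (A : algebra) (lA : is_lattice A) (x y : A) :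
  ((meet x x = x) * (meet y y = y) * (meet y x = meet x y) *
   (meet (meet x y) (meet x y) = meet x y) *
   (meet (join x y) (join x y) = join x y) *
   (meet x (meet x y) = meet x y) * (meet y (meet x y) = meet x y) *
   (meet (meet x y) x = meet x y) * (meet (meet x y) y = meet x y) *
   (meet x (join x y) = x) * (meet y (join x y) = y) *
   (meet (join x y) x = x) * (meet (join x y) y = y) *
   (meet (meet x y) (join x y) = meet x y) *
   (meet (join x y) (meet x y) = meet x y))%type.
Proof. exact: (@lattice_joinE (dual_algebra A) (dual_lattice A lA) x y). Qed.

(** The alternative depends on [t] alone, so it is the same for a lattice and for its derived
    algebra. *)
Lemma lattice_term_op (t : binary_term) :
  [\/ forall A : algebra, is_lattice A -> forall x y : A, term_op t x y = x,
      forall A : algebra, is_lattice A -> forall x y : A, term_op t x y = y,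
      forall A : algebra, is_lattice A ->
        forall x y : A, term_op t x y = join x y
    | forall A : algebra, is_lattice A ->
        forall x y : A, term_op t x y = meet x y].
Proof.
elim: t => [||t1 IH1 t2 IH2|t1 IH1 t2 IH2].
- by constructor 1.
- by constructor 2.
(* The constructors spell out the join table: one row per value of [t1], one column per value of
   [t2]. *)
- case: IH1 => E1; case: IH2 => E2;
    [> constructor 1 | constructor 3 | constructor 3 | constructor 1
     | constructor 3 | constructor 2 | constructor 3 | constructor 2
     | constructor 3 | constructor 3 | constructor 3 | constructor 3
     | constructor 1 | constructor 2 | constructor 3 | constructor 4];
    by move=> A lA x y; rewrite /= E1 // E2 // ?(lattice_joinE A lA x y).
- case: IH1 => E1; case: IH2 => E2;
    [> constructor 1 | constructor 4 | constructor 1 | constructor 4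
     | constructor 4 | constructor 2 | constructor 2 | constructor 4
     | constructor 1 | constructor 2 | constructor 3 | constructor 4
     | constructor 4 | constructor 4 | constructor 4 | constructor 4];
    by move=> A lA x y; rewrite /= E1 // E2 // ?(lattice_meetE A lA x y).
Qed.

Lemma subsingleton_hom (A B : algebra) (f : A -> B) :
  (forall a b : B, a = b) -> is_hom f.
Proof. by move=> B1; split=> a b; apply: B1. Qed.

(** A homomorphism instead of an equality of algebras: closure under H needs no more. *)
Lemma derived_derived_hom (s : hypersubstitution) (A : algebra) :
  is_lattice A -> is_lattice (derived_algebra s A) ->
  @is_hom (derived_algebra s (derived_algebra s A)) A id.
Proof.
case: s => j m lA lB; set B := derived_algebra _ A in lB *.
have jB (a b : A) : @join B a b = term_op j a b by [].
have mB (a b : A) : @meet B a b = term_op m a b by [].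
have [jC mC _ _ [jmK _]] := lB.
have [jAC mAC _ _ _] := lA.
case: (lattice_term_op j) => Ej; case: (lattice_term_op m) => Em;
  (* Both symbols are sent to operations, and to different ones. *)
  try by split=> a b; rewrite /= ?(Ej B lB) ?(Em B lB) ?jB ?mB ?Ej ?Em.
all: apply: subsingleton_hom => a b.
(* A commutative projection identifies any two elements. *)
all: try by have := jC a b; rewrite !jB !Ej.
all: try by have := mC a b; rewrite !mB !Em.
(* With join used twice, absorption in [B] reads [join c (join c d) = c], so
   [a = join a b = join b a = b]. *)
- have K (c d : A) : join c d = c.
    by have := jmK c d; rewrite jB mB Ej // Em // (lattice_joinE A lA c d).
  by rewrite -(K a b) jAC K.
- have K (c d : A) : meet c d = c.
    by have := jmK c d; rewrite jB mB Ej // Em // (lattice_meetE A lA c d).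
  by rewrite -(K a b) mAC K.
Qed.

Lemma variety_generated_by_variety (K : set algebra) :
  is_variety (variety_generated_by K).
Proof.
split=> [A B f hf sf KA|A B f hf injf KB|I A KA] W [varW KW];
  have [WH WS WP] := varW.
- by apply: (WH A B f) => //; apply: KA.
- by apply: (WS A B f) => //; apply: KB.
- by apply: WP => i; apply: KA.
Qed.

Theorem theorem3p1 (V : set algebra) (hV : is_variety_of_lattices V) : fluid V.
Proof.
have [_ latV] := hV.
apply/fluidE => s sV; apply/seteqP; split=> // A VA.
have derived_sub B : V B -> derived_variety V s (derived_algebra s B).
  by move=> VB W [_]; apply; exists B.
have VA' : V (derived_algebra s A) by apply: sV; apply: derived_sub.
have [closedH _ _] := variety_generated_by_variety (derived_algebra s @` V).
(* [A] is the image under [id] of its second derived algebra, which [VA'] puts in the derived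
   variety. *)
apply: (closedH _ A _ (derived_derived_hom s A (latV _ VA) (latV _ VA'))).
  by move=> a; exists a.
exact: derived_sub.
Qed.
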